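(* Let $A$ be an $\ell_\infty$-embeddable uniform algebra (or an $\ell_\infty$-embeddable abelian $C^*$-algebra). Then $A$ is universally $(\ell_\infty\setminus c_0)$-embeddable if and only if $K(A)=\{0\}$.
   Context: All algebras are associative and complex; $\ell_\infty$ is the $C^*$-algebra of bounded complex sequences and $c_0$ its ideal of null sequences. A uniform algebra is a commutative Banach algebra $A$ (not necessarily unital) with $\|a^2\|=\|a\|^2$ for all $a\in A$. For a Banach algebra $A$, an element $a\in A$ is compact if the operator $U_a\colon A\to A$, $U_a(x)=axa$, is compact; $K(A)$ is the set of compact elements of $A$. Let $B$ be a $C^*$-algebra. A $B$-embedding of $A$ is an injective linear map $\phi\colon A\to B$ preserving the structure of $A$: isometric and an algebra homomorphism if $A$ is a Banach algebra (in particular a uniform algebra); a $^*$-homomorphism if $A$ is a $C^*$-algebra. $A$ is $B$-embeddable if a $B$-embedding of $A$ exists. For $Y\subset B$, a $B$-embedding $\phi$ avoids $Y$ if $\phi(A)\cap Y=\{0\}$. $A$ is $(B\setminus Y)$-embeddable if there is a $B$-embedding of $A$ that avoids $Y$; $A$ is universally $(B\setminus Y)$-embeddable if it is $(B\setminus Y)$-embeddable and every $B$-embedding of $A$ avoids $Y$. *)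

(* Defs.v *)
From HB Require Import structures.
From mathcomp Require Import all_boot all_order all_algebra.
From mathcomp Require Import complex.
From mathcomp Require Import boolp classical_sets functions reals.
From mathcomp Require Import topology normedtype.

Set Implicit Arguments.
Unset Strict Implicit.
Unset Printing Implicit Defensive.

Import Order.TTheory GRing.Theory Num.Theory.
Import numFieldNormedType.Exports.

Local Open Scope classical_set_scope.
Local Open Scope complex_scope.
Local Open Scope ring_scope.

(* The complex numbers are [R[i]] with [R : realType].  Norms on a normed
   module over [R[i]] take their values in [R[i]]; they are nonnegative there,
   hence real, and [x <= y] in [R[i]] means that [y - x] is a nonnegative
   real. *)

(* The ring structures of MathComp are all unital, so the product of a not
   necessarily unital algebra is a separate operation [amul]. *)
HB.mixin Record isBanachAlgebra (R : realType) A
    & CompleteNormedModule R[i] A := {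
  amul : A -> A -> A;
  amulA : associative amul;
  amulDl : left_distributive amul +%R;
  amulDr : right_distributive amul +%R;
  amulZl : forall (k : R[i]) (x y : A), amul (k *: x) y = k *: amul x y;
  amulZr : forall (k : R[i]) (x y : A), amul x (k *: y) = k *: amul x y;
  normr_amul_le : forall x y : A, `|amul x y| <= `|x| * `|y|
}.

#[short(type="banachAlgType")]
HB.structure Definition BanachAlgebra (R : realType) :=
  {A of CompleteNormedModule R[i] A & isBanachAlgebra R A}.

HB.mixin Record isCstarAlgebra (R : realType) A & BanachAlgebra R A := {
  star : A -> A;
  starK : involutive star;
  starD : {morph star : x y / x + y};
  starZ : forall (k : R[i]) (x : A), star (k *: x) = k^* *: star x;
  starM : forall x y : A, star (amul x y) = amul (star y) (star x);
  normr_amul_star : forall x : A, `|amul (star x) x| = `|x| ^+ 2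
}.

#[short(type="cstarAlgType")]
HB.structure Definition CstarAlgebra (R : realType) :=
  {A of BanachAlgebra R A & isCstarAlgebra R A}.

Definition abelian_algebra (R : realType) (A : banachAlgType R) : Prop :=
  commutative (@amul R A).

Definition uniform_algebra (R : realType) (A : banachAlgType R) : Prop :=
  abelian_algebra A /\ forall a : A, `|amul a a| = `|a| ^+ 2.

Definition compact_operator (R : realType) (V W : normedModType R[i])
    (T : V -> W) : Prop :=
  compact (closure (T @` [set x : V | `|x| <= 1])).

Definition compact_elements (R : realType) (A : banachAlgType R) : set A :=
  [set a | compact_operator (fun x : A => amul (amul a x) a)].
Arguments compact_elements {R} A.

Definition algebra_embedding (R : realType) (A B : banachAlgType R)
    (phi : {linear A -> B}) : Prop :=
  [/\ injective phi,
      forall x y : A, phi (amul x y) = amul (phi x) (phi y) &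
      forall x : A, `|phi x| = `|x|].

Definition star_embedding (R : realType) (A B : cstarAlgType R)
    (phi : {linear A -> B}) : Prop :=
  [/\ injective phi,
      forall x y : A, phi (amul x y) = amul (phi x) (phi y) &
      forall x : A, phi (star x) = star (phi x)].

Arguments algebra_embedding {R} A B phi.
Arguments star_embedding {R} A B phi.

(* [E] is the class of structure-preserving embeddings under consideration:
   [algebra_embedding] when [A] is regarded as a Banach algebra and
   [star_embedding] when it is regarded as a C*-algebra. *)
Section embeddability.
Context (R : realType) (A B : banachAlgType R).
Implicit Types (E : {linear A -> B} -> Prop) (Y : set B).

Definition avoids (phi : {linear A -> B}) Y : Prop :=
  range phi `&` Y = [set 0].

Definition embeddable E : Prop := exists phi, E phi.

Definition embeddable_avoiding E Y : Prop := exists2 phi, E phi & avoids phi Y.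

Definition universally_embeddable_avoiding E Y : Prop :=
  embeddable_avoiding E Y /\ forall phi, E phi -> avoids phi Y.

End embeddability.

Section linfty.
Context (R : realType).
(* [R[i]^o] is [R[i]] with the topology of its modulus. *)
Local Notation C := (R[i]^o).
Implicit Types u v : nat -> C.

Definition bounded_seqs : {pred nat -> C} :=
  [pred u | `[< exists M : R[i], forall n, `|u n| <= M >]].

Record linfty := Linfty {
  linfty_seq : nat -> C;
  _ : linfty_seq \in bounded_seqs
}.

HB.instance Definition _ := [isSub for linfty_seq].
HB.instance Definition _ := [Choice of linfty by <:].

Lemma bounded_seqsP u :
  reflect (exists M : R[i], forall n, `|u n| <= M) (u \in bounded_seqs).
Proof. exact: asboolP. Qed.

Lemma bounded_seqs_submod : submod_closed bounded_seqs.
Proof.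
split=> [|k u v /bounded_seqsP[M uM] /bounded_seqsP[N vN]].
  by apply/bounded_seqsP; exists 0 => n; rewrite normr0.
apply/bounded_seqsP; exists (`|k| * M + N) => n.
apply: (le_trans (ler_normD _ _)); apply: lerD => //.
by rewrite [X in `|X|](_ : _ = k * u n)// normrM ler_wpM2l.
Qed.

HB.instance Definition _ :=
  GRing.isSubmodClosed.Build _ _ bounded_seqs bounded_seqs_submod.
HB.instance Definition _ := [SubChoice_isSubLmodule of linfty by <:].

Definition linfty_norm (x : linfty) : R[i] :=
  (sup (range (fun n => complex.Re `|linfty_seq x n|)))%:C.

Lemma linfty_norm_ub (x : linfty) n : `|linfty_seq x n| <= linfty_norm x.
Proof.
have /bounded_seqsP[M xM] := valP x.
rewrite -[leLHS]RRe_real ?normr_real// lecR.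
apply: sup_ubound; last by exists n.
exists (complex.Re M) => _ [k _ <-].
by have := xM k; rewrite lecE => /andP[].
Qed.

Lemma linfty_norm_le (x : linfty) (M : R[i]) :
  (forall n, `|linfty_seq x n| <= M) -> linfty_norm x <= M.
Proof.
move=> xM; have M0 : 0 <= M by apply: le_trans (xM 0%N).
rewrite -[leRHS]RRe_real ?ger0_real// lecR.
apply: ge_sup; first by exists (complex.Re `|linfty_seq x 0%N|); exists 0%N.
by move=> _ [n _ <-]; have := xM n; rewrite lecE => /andP[].
Qed.

Lemma linfty_seqP (x y : linfty) : linfty_seq x =1 linfty_seq y -> x = y.
Proof. by move=> xy; apply: val_inj; apply/funext. Qed.

Lemma linfty_normD (x y : linfty) :
  linfty_norm (x + y) <= linfty_norm x + linfty_norm y.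
Proof.
apply: linfty_norm_le => n; apply: (le_trans (ler_normD _ _)).
by apply: lerD; exact: linfty_norm_ub.
Qed.

Lemma linfty_normZ (k : R[i]) (x : linfty) :
  linfty_norm (k *: x) = `|k| * linfty_norm x.
Proof.
have le (l : R[i]) (y : linfty) : linfty_norm (l *: y) <= `|l| * linfty_norm y.
  apply: linfty_norm_le => n.
  rewrite [X in `|X|](_ : _ = l * linfty_seq y n)// normrM.
  by rewrite ler_wpM2l// linfty_norm_ub.
apply/eqP; rewrite eq_le le /=.
have [->|k0] := eqVneq k 0.
  by rewrite normr0 mul0r (le_trans _ (linfty_norm_ub _ 0%N)).
rewrite -ler_pdivlMl ?normr_gt0// -normfV.
by rewrite -{1}[x](scalerK k0) le.
Qed.

Lemma linfty_norm0_eq0 (x : linfty) : linfty_norm x = 0 -> x = 0.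
Proof.
move=> x0; apply: linfty_seqP => n; apply/eqP.
by rewrite -normr_le0 -x0 linfty_norm_ub.
Qed.

HB.instance Definition _ := Lmodule_isNormed.Build R[i] linfty
  linfty_normD linfty_normZ linfty_norm0_eq0.

Lemma linfty_seqD (x y : linfty) n :
  linfty_seq (x + y) n = linfty_seq x n + linfty_seq y n.
Proof. by []. Qed.

Lemma linfty_seqB (x y : linfty) n :
  linfty_seq (x - y) n = linfty_seq x n - linfty_seq y n.
Proof. by []. Qed.

Lemma linfty_seqZ (k : R[i]) (x : linfty) n :
  linfty_seq (k *: x) n = k * linfty_seq x n.
Proof. by []. Qed.

Lemma linfty_normE (x : linfty) : `|x| = linfty_norm x.
Proof. by []. Qed.

Lemma complex_cauchy_cvg (F : set_system C) :
  ProperFilter F -> cauchy F -> cvg F.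
Proof.
move=> FF /cauchy_ballP cF.
have normRe (z : C) : `|complex.Re z|%:C <= `|z| by exact: normc_ge_Re.
have normIm (z : C) : `|complex.Im z|%:C <= `|z|.
  case: z => a b; rewrite normc_def lecR /= -sqrtr_sqr.
  by rewrite ler_sqrt ?addr_ge0 ?sqr_ge0// lerDr sqr_ge0.
have cvgP (f : C -> R) : {morph f : x y / x - y} ->
    (forall z, `|f z|%:C <= `|z|) -> cvg (f @ F).
  move=> fB fle; apply: cauchy_cvg; apply/cauchy_ballP => e e0.
  have := cF e%:C; rewrite ltcR => /(_ e0).
  rewrite /prop_near2 /= => -[[P Q] [FP FQ] PQ].
  exists (f @` P, f @` Q).
    split; [apply: filterS FP|apply: filterS FQ] => z zP; by exists z.
  move=> [_ _] /= [[x Px <-] [y Qy <-]].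
  rewrite /ball/= -fB -ltcR; apply: le_lt_trans (fle _) _.
  exact: (PQ (x, y)).
have cRe : cvg (@complex.Re R @ F) by apply: cvgP => // -[? ?] [? ?].
have cIm : cvg (@complex.Im R @ F) by apply: cvgP => // -[? ?] [? ?].
apply/cvg_ex; exists (lim (@complex.Re R @ F) +i* lim (@complex.Im R @ F)).
apply/cvgrPdist_lt => e e0.
have eE : e = (complex.Re e)%:C by rewrite RRe_real ?gtr0_real.
have e2 : 0 < complex.Re e / 2 by rewrite divr_gt0// -ltcR -eE.
move/cvgrPdist_lt : cRe => /(_ _ e2) nRe.
move/cvgrPdist_lt : cIm => /(_ _ e2) nIm.
near=> z.
rewrite [X in `|X|]complexE; apply: le_lt_trans (ler_normD _ _) _.
rewrite normrM (_ : `|'i| = 1) ?mul1r; last first.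
  by rewrite normc_def /= expr0n/= add0r expr1n sqrtr1.
rewrite eE [ltRHS](_ : _ =
  (complex.Re e / 2)%:C + (complex.Re e / 2)%:C); last first.
  by rewrite -raddfD/= -splitr.
have normR (r : R) : `|r%:C| = `|r|%:C.
  by rewrite normc_def /= expr0n/= addr0 sqrtr_sqr.
rewrite !normR; apply: ltrD; rewrite ltcR.
- by rewrite raddfB/=; near: z.
- by rewrite raddfB/=; near: z.
Unshelve. all: by end_near. Qed.

Lemma linfty_cauchy_cvg (F : set_system linfty) :
  ProperFilter F -> cauchy F -> cvg F.
Proof.
move=> FF /cauchy_ballP cF.
have cn n : cvg ((fun x : linfty => linfty_seq x n : C) @ F).
  apply: complex_cauchy_cvg; apply/cauchy_ballP => e e0.
  have [[P Q] [FP FQ] PQ] := cF e e0.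
  exists ((fun x => linfty_seq x n) @` P, (fun x => linfty_seq x n) @` Q).
    split; [apply: filterS FP|apply: filterS FQ] => z zP; by exists z.
  move=> [_ _] /= [[x Px <-] [y Qy <-]].
  rewrite /ball/= -linfty_seqB.
  by apply: le_lt_trans (linfty_norm_ub _ _) _; exact: (PQ (x, y)).
pose l n : C := lim ((fun x : linfty => linfty_seq x n : C) @ F).
have close (e : R[i]) : 0 < e ->
    \forall x \near F, forall n, `|l n - linfty_seq x n| <= e.
  move=> e0; have e2 : 0 < e / 2 by rewrite divr_gt0.
  have [[P Q] [FP FQ] PQ] := cF _ e2.
  apply: filterS FP => x Px n.
  have /cvgrPdist_lt/(_ _ e2) ln := cn n.
  have [y [Qy ly]] := filter_ex (filterI FQ ln).
  rewrite (splitr e) -(subrKA (linfty_seq y n)).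
  apply: le_trans (ler_normD _ _) _; apply: lerD; first exact: ltW.
  rewrite distrC -linfty_seqB; apply: le_trans (linfty_norm_ub _ _) _.
  exact/ltW/(PQ (x, y)).
have bl : l \in bounded_seqs.
  have [x xl] := filter_ex (close 1 ltr01).
  apply/bounded_seqsP; exists (1 + linfty_norm x) => n.
  rewrite -[l n](subrK (linfty_seq x n)).
  apply: le_trans (ler_normD _ _) _; apply: lerD => //.
  exact: linfty_norm_ub.
apply/cvg_ex; exists (Linfty bl); apply/cvgrPdist_le => e e0.
by apply: filterS (close e e0) => x xl; apply: linfty_norm_le => n; exact: xl.
Qed.

HB.instance Definition _ := Uniform_isComplete.Build linfty linfty_cauchy_cvg.

Lemma linfty_mul_subproof (x y : linfty) :
  (fun n => linfty_seq x n * linfty_seq y n : C) \in bounded_seqs.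
Proof.
apply/bounded_seqsP; exists (linfty_norm x * linfty_norm y) => n.
by rewrite normrM ler_pM// linfty_norm_ub.
Qed.

Definition linfty_mul (x y : linfty) : linfty := Linfty (linfty_mul_subproof x y).

Lemma linfty_star_subproof (x : linfty) :
  (fun n => (linfty_seq x n)^* : C) \in bounded_seqs.
Proof.
apply/bounded_seqsP; exists (linfty_norm x) => n.
by rewrite normcJ linfty_norm_ub.
Qed.

Definition linfty_star (x : linfty) : linfty := Linfty (linfty_star_subproof x).

Lemma linfty_mulA : associative linfty_mul.
Proof. by move=> x y z; apply: linfty_seqP => n /=; rewrite mulrA. Qed.

Lemma linfty_mulDl : left_distributive linfty_mul +%R.
Proof. by move=> x y z; apply: linfty_seqP => n; exact: mulrDl. Qed.

Lemma linfty_mulDr : right_distributive linfty_mul +%R.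
Proof. by move=> x y z; apply: linfty_seqP => n; exact: mulrDr. Qed.

Lemma linfty_mulZl (k : R[i]) (x y : linfty) :
  linfty_mul (k *: x) y = k *: linfty_mul x y.
Proof. by apply: linfty_seqP => n; exact: (esym (mulrA _ _ _)). Qed.

Lemma linfty_mulZr (k : R[i]) (x y : linfty) :
  linfty_mul x (k *: y) = k *: linfty_mul x y.
Proof. by apply: linfty_seqP => n; exact: mulrCA. Qed.

Lemma linfty_normM (x y : linfty) : `|linfty_mul x y| <= `|x| * `|y|.
Proof.
apply: linfty_norm_le => n.
by rewrite normrM ler_pM// linfty_norm_ub.
Qed.

HB.instance Definition _ := isBanachAlgebra.Build R linfty linfty_mulA
  linfty_mulDl linfty_mulDr linfty_mulZl linfty_mulZr linfty_normM.

Lemma linfty_starK : involutive linfty_star.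
Proof. by move=> x; apply: linfty_seqP => n; exact: conjcK. Qed.

Lemma linfty_starD : {morph linfty_star : x y / x + y}.
Proof. by move=> x y; apply: linfty_seqP => n; exact: rmorphD. Qed.

Lemma linfty_starZ (k : R[i]) (x : linfty) :
  linfty_star (k *: x) = k^* *: linfty_star x.
Proof. by apply: linfty_seqP => n; exact: rmorphM. Qed.

Lemma linfty_starM (x y : linfty) :
  linfty_star (amul x y) = amul (linfty_star y) (linfty_star x).
Proof. by apply: linfty_seqP => n; rewrite /= rmorphM mulrC. Qed.

Lemma linfty_norm_star (x : linfty) :
  `|amul (linfty_star x) x| = `|x| ^+ 2.
Proof.
apply/eqP; rewrite eq_le; apply/andP; split.
  apply: linfty_norm_le => n; rewrite /= normrM normcJ -expr2.
  by rewrite lerXn2r ?nnegrE// linfty_norm_ub.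
rewrite -(@sqr_sqrtc R `|amul _ _|) lerXn2r ?nnegrE ?sqrtc_ge0//.
apply: linfty_norm_le => n.
rewrite -(@ler_pXn2r _ 2) ?nnegrE ?sqrtc_ge0// sqr_sqrtc.
apply: le_trans (linfty_norm_ub _ n).
by rewrite /= normrM normcJ -expr2.
Qed.

HB.instance Definition _ := isCstarAlgebra.Build R linfty linfty_starK
  linfty_starD linfty_starZ linfty_starM linfty_norm_star.

Definition c0 : set linfty := [set x | linfty_seq x @ \oo --> (0 : C)].

End linfty.

Arguments c0 R : clear implicits.

(* Main.v *)
From HB Require Import structures.
Require Import Defs.
From mathcomp Require Import all_boot all_order all_algebra.
From mathcomp Require Import complex boolp classical_sets reals.
From mathcomp Require Import topology normedtype.
From mathcomp Require Import sequences ring lra.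

(** The proof works with the coordinates of an embedding [phi], that is, with
    the characters [entry phi i] of [A]; as [phi] is injective, an identity in
    [A] may be checked coordinatewise in the complex numbers.

    Suppose first that [phi] is isometric.  If [phi a] is a null sequence, then
    the image of the unit ball under [x |-> a x a] is bounded coordinatewise by
    the null sequence [|phi a|^2], so it is totally bounded and [a] is compact
    ([c0_compact_element]).  Hence, if [A] has no nonzero compact element,
    every embedding avoids [c0].

    Conversely, let [a <> 0] be compact.  A limit of suitable powers of an
    element of norm one is an idempotent, which is 1 exactly on the coordinates
    where the element has modulus one ([power_idempotent]).  Applied to [a],
    this gives an idempotent [e <> 0] such that the unit ball of [e A] lies in a
    compact set.  By compactness, among the idempotents below [e] which are 1
    at a fixed coordinate [n0] there is a least one, [g].  An element of [g A]
    vanishing at [n0] is zero, since otherwise its powers would yield an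
    idempotent [f] for which [g - f] is smaller than [g].  So [g A] is the line
    through [g] ([minimal_idempotent]).  Then
    [x |-> (x_n0, phi (x - g x))] is again an embedding, and it maps [g] to a
    sequence with one nonzero term ([split_map]); it does not avoid [c0].

    For abelian C*-algebras an embedding is only assumed to be an injective
    star-homomorphism, and it must be shown to be isometric
    ([star_embedding_isometric]).  The tool is the square root of [1 - x] for
    [x] self-adjoint of norm at most one ([sqrt_one_sub]).  It makes the
    coordinates contractive.  If some element were to lose norm, its
    normalized square raised to a high power would be a self-adjoint [k] of
    norm one with [phi k ^+ 2 <= 1/2].  For [h = k^2] the element
    [4 h - 4 h^2] has norm at most one, so the square root
    [1 - z = |1 - 2 h|] of [1 - (4 h - 4 h^2)] is available with [|z| <= 1].
    But [phi h <= 1/2] forces [phi z = 2 phi h], so [z = 2 h] has norm 2. *)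

Set Implicit Arguments.
Unset Strict Implicit.
Unset Printing Implicit Defensive.

Import Order.TTheory GRing.Theory Num.Theory.
Import numFieldNormedType.Exports.

Local Open Scope classical_set_scope.
Local Open Scope complex_scope.
Local Open Scope ring_scope.

(** * Limits and ultrafilters *)

Lemma cluster_approx (K : numFieldType) (V : normedModType K)
    (F : set_system V) (p : V) (B : set V) (e : K) :
  cluster F p -> F B -> 0 < e -> exists2 x, B x & `|p - x| < e.
Proof.
move=> cl FB e0.
have [x [Bx]] := cl _ _ FB (nbhsx_ballx p _ e0).
by rewrite -ball_normE => px; exists x.
Qed.

Lemma closure_approx (K : numFieldType) (V : normedModType K)
    (E : set V) (p : V) (e : K) :
  closure E p -> 0 < e -> exists2 x, E x & `|p - x| < e.
Proof.
move=> cE e0; have [x [Ex]] := cE _ (nbhsx_ballx p _ e0).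
by rewrite -ball_normE => px; exists x.
Qed.

Lemma approx_closure (K : numFieldType) (V : normedModType K)
    (E : set V) (p : V) :
  (forall e, 0 < e -> exists2 x, E x & `|p - x| < e) -> closure E p.
Proof.
move=> pE B /nbhs_ballP[e /= e0 eB].
have [x Ex px] := pE e e0; exists x; split => //.
by apply: eB; rewrite -ball_normE.
Qed.

Lemma compact_sequence_cluster (K : numFieldType) (V : normedModType K)
    (S : set V) (u : nat -> V) :
  compact S -> (forall n, S (u n)) ->
  exists2 c, S c &
    forall e N, 0 < e -> exists2 n, (N <= n)%N & `|c - u n| < e.
Proof.
move=> cS Su; have uS : (u @ \oo) S by exists 0%N => // n _; exact: Su.
have [c [Sc cl]] := cS (u @ \oo) _ uS.
exists c => // e N e0.
have FN : (u @ \oo) (u @` [set n | (N <= n)%N]).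
  by exists N => // n Nn; exists n.
by have [_ [n Nn <-] cn] := cluster_approx cl FN e0; exists n.
Qed.

Lemma eq_of_approx (K : numFieldType) (V : normedModType K) (z w : V) :
  (forall e, 0 < e -> `|z - w| <= e) -> z = w.
Proof.
move=> zw; apply/eqP; rewrite -subr_eq0 -normr_le0.
apply/ler_addgt0Pl => e e0; rewrite addr0; exact: zw.
Qed.

(** Sets with two elements are closed.  This is how coordinates equal to 0 or 1
    pass to limits of idempotents. *)
Lemma mem2_of_approx (K : numFieldType) (V : normedModType K) (z a b : V) :
  (forall e, 0 < e -> exists2 w, w = a \/ w = b & `|z - w| < e) ->
  z = a \/ z = b.
Proof.
move=> zw; apply: contrapT => /not_orP[za zb].
have za0 : 0 < `|z - a| by rewrite normr_gt0 subr_eq0; apply/eqP.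
have zb0 : 0 < `|z - b| by rewrite normr_gt0 subr_eq0; apply/eqP.
have m0 : 0 < Num.min `|z - a| `|z - b| by rewrite /Order.min; case: ifP.
have [w [->|->]] := zw _ m0; rewrite /Order.min; case: ifP => h.
- by rewrite ltxx.
- by rewrite h.
- by move/(lt_trans h); rewrite ltxx.
- by rewrite ltxx.
Qed.

(** Bounded functions converge along ultrafilters, by compactness of segments;
    the complex case follows by taking real and imaginary parts. *)
Lemma ultra_real_cvg (R : realType) (T : Type) (F : set_system T)
    (f : T -> R) (M : R) : UltraFilter F ->
  F [set y | `|f y| <= M] ->
  exists l, forall e, 0 < e -> F [set y | `|f y - l| < e].
Proof.
move=> UF FM.
have FI : (f @ F) `[- M, M]%classic.
  by apply: (@filterS _ F _ _ _ _ FM) => y /= yM; rewrite in_itv/= -ler_norml.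
have [l [_ cl]] := segment_compact _ FI.
exists l => e e0.
have [//|nF] := @in_ultra_setVsetC _ F [set y | `|f y - l| < e] UF.
have fF : (f @ F) (f @` (~` [set y | `|f y - l| < e])).
  by apply: (@filterS _ F _ _ _ _ nF) => y ney; exists y.
have [_ [[y ney <-]]] := cl _ _ fF (nbhsx_ballx l e e0).
by rewrite -ball_normE/= distrC.
Qed.

Lemma ultra_complex_cvg (R : realType) (T : Type) (F : set_system T)
    (f : T -> R[i]) (M : R[i]) : UltraFilter F ->
  F [set y | `|f y| <= M] ->
  exists l, forall e, 0 < e -> F [set y | `|f y - l| < e].
Proof.
move=> UF FM.
have normRe (z : R[i]) : `|complex.Re z|%:C <= `|z| by exact: normc_ge_Re.
have normIm (z : R[i]) : `|complex.Im z|%:C <= `|z|.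
  case: z => a b; rewrite normc_def lecR /= -sqrtr_sqr.
  by rewrite ler_sqrt ?addr_ge0 ?sqr_ge0// lerDr sqr_ge0.
have bd (g : R[i] -> R) : (forall z, `|g z|%:C <= `|z|) ->
    F [set y | `|g (f y)| <= complex.Re M].
  move=> gle; apply: filterS FM => y /= /(le_trans (gle _)).
  by rewrite lecE => /andP[].
have [lr lrP] := ultra_real_cvg UF (bd _ normRe).
have [li liP] := ultra_real_cvg UF (bd _ normIm).
exists (lr +i* li) => e e0.
have eE : e = (complex.Re e)%:C by rewrite RRe_real ?gtr0_real.
have e2 : 0 < complex.Re e / 2 by rewrite divr_gt0// -ltcR -eE.
apply: filterS2 (lrP _ e2) (liP _ e2) => y /= yr yi.
rewrite [X in `|X|]complexE; apply: le_lt_trans (ler_normD _ _) _.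
rewrite normrM (_ : `|'i| = 1) ?mul1r; last first.
  by rewrite normc_def /= expr0n/= add0r expr1n sqrtr1.
rewrite eE [ltRHS](_ : _ =
  (complex.Re e / 2)%:C + (complex.Re e / 2)%:C); last first.
  by rewrite -raddfD/= -splitr.
have normR (r : R) : `|r%:C| = `|r|%:C.
  by rewrite normc_def /= expr0n/= addr0 sqrtr_sqr.
by rewrite !normR; apply: ltrD; rewrite ltcR raddfB.
Qed.

(** * Coordinates of an embedding *)
Section coordinates.
Context (R : realType) (A : banachAlgType R) (phi : {linear A -> linfty R}).
Implicit Types (x y : A) (n : nat).

Definition entry n x : R[i] := linfty_seq (phi x) n.

Lemma entry0 n : entry n 0 = 0. Proof. by rewrite /entry linear0. Qed.
Lemma entryD n x y : entry n (x + y) = entry n x + entry n y.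
Proof. by rewrite /entry linearD. Qed.
Lemma entryB n x y : entry n (x - y) = entry n x - entry n y.
Proof. by rewrite /entry linearB. Qed.
Lemma entryZ n (k : R[i]) x : entry n (k *: x) = k * entry n x.
Proof. by rewrite /entry linearZ. Qed.

Lemma injective_entry x y :
  injective phi -> (forall n, entry n x = entry n y) -> x = y.
Proof. by move=> phiI xy; apply: phiI; apply: linfty_seqP => n; exact: xy. Qed.

Lemma hom_entryM n x y :
  (forall x y, phi (amul x y) = amul (phi x) (phi y)) ->
  entry n (amul x y) = entry n x * entry n y.
Proof. by rewrite /entry => ->. Qed.

Context (phiE : algebra_embedding A (linfty R) phi).

Lemma entryM n x y : entry n (amul x y) = entry n x * entry n y.
Proof. by apply: hom_entryM; case: phiE. Qed.

Lemma entry_inj x y : (forall n, entry n x = entry n y) -> x = y.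
Proof. by apply: injective_entry; case: phiE. Qed.

Lemma entry_le n x : `|entry n x| <= `|x|.
Proof. by case: phiE => _ _ <-; rewrite linfty_normE linfty_norm_ub. Qed.

Lemma norm_le_entry x (M : R[i]) : (forall n, `|entry n x| <= M) -> `|x| <= M.
Proof. by case: phiE => _ _ <- ?; rewrite linfty_normE linfty_norm_le. Qed.

(** Coordinates are contractive, hence continuous. *)
Lemma closure_entry2 (E : set A) x n (a b : R[i]) : closure E x ->
  (forall y, E y -> entry n y = a \/ entry n y = b) ->
  entry n x = a \/ entry n x = b.
Proof.
move=> Ex Eab; apply: (@mem2_of_approx _ R[i]^o) => e e0.
have [y Ey xy] := closure_approx Ex e0.
exists (entry n y); first exact: Eab.
by rewrite -entryB; apply: le_lt_trans (entry_le _ _) _.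
Qed.

(** An ultrafilter on the closed image [closure E] of the unit ball converges in
    each coordinate.  All of [closure E] is dominated by the null sequence
    [|a_n|^2], so only finitely many coordinates matter up to a given precision,
    and the ultrafilter is Cauchy for the norm. *)
Lemma c0_compact_element a : c0 R (phi a) -> compact_elements A a.
Proof.
move=> ca; rewrite /compact_elements /compact_operator /=.
set E := _ @` _.
have EP n y : E y -> `|entry n y| <= `|entry n a| ^+ 2.
  move=> [x /= x1 <-]; rewrite !entryM !normrM mulrAC -expr2.
  by rewrite ler_piMr ?exprn_ge0// (le_trans (entry_le _ _)).
have cEP n y : closure E y -> `|entry n y| <= `|entry n a| ^+ 2.
  move=> Ey; apply/ler_addgt0Pr => e e0.
  have [x Ex yx] := closure_approx Ey e0.
  rewrite -[y](subrK x) addrC entryD; apply: le_trans (ler_normD _ _) _.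
  apply: lerD; first exact: EP.
  exact/(le_trans (entry_le _ _))/ltW.
rewrite compact_ultra => F UF FE.
have FC n : F [set y | `|entry n y| <= `|entry n a| ^+ 2].
  by apply: filterS FE => y; exact: cEP.
have [l lP] := choice (fun n => ultra_complex_cvg UF (FC n)).
have : cauchy F.
  apply/cauchy_ballP => e e0.
  have e3 : 0 < e / 3 by rewrite divr_gt0.
  have [N NP] : exists N, forall n, (N <= n)%N -> `|entry n a| ^+ 2 <= e / 3.
    have s0 : 0 < sqrtC (e / 3) by rewrite sqrtC_gt0.
    have /cvgrPdist_lt/(_ _ s0)[N _ NP] := ca.
    exists N => n /NP /=; rewrite sub0r normrN => /ltW an.
    by rewrite -[leRHS]sqrtCK lerXn2r ?nnegrE// ltW.
  pose close N' := [set y | forall n, (n < N')%N -> `|entry n y - l n| < e / 3].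
  have FN N' : F (close N').
    elim: N' => [|N' IH]; first exact: filterS filterT.
    apply: filterS2 IH (lP N' _ e3) => y h1 h2 n.
    by rewrite ltnS leq_eqVlt => /predU1P[->|/h1].
  pose P := closure E `&` close N.
  have FP : F P by exact: filterI.
  exists (P, P) => //.
  move=> [x y] /= [[cx xl] [cy yl]]; rewrite -ball_normE /=.
  apply: (@le_lt_trans _ _ (e / 3 + e / 3)); last first.
    by rewrite -subr_gt0 (_ : _ - _ = e / 3)//; field.
  apply: norm_le_entry => n; rewrite entryB.
  have [nN|Nn] := ltnP n N.
    rewrite -(subrKA (l n)); apply: le_trans (ler_normD _ _) _.
    by rewrite lerD// 1?ltW ?xl// distrC yl.
  apply: le_trans (ler_normB _ _) _.
  by rewrite lerD// (le_trans (cEP _ _ _))// NP.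
move/cauchy_cvg => /cvg_ex[p Fp]; exists p; split=> //.
by apply: closed_closure => B /Fp FB; apply: (@filter_ex _ F); exact: filterI.
Qed.

End coordinates.

(** * Idempotents from compact elements *)

Lemma expr_small (R : realType) (r e : R[i]) : 0 <= r -> r < 1 -> 0 < e ->
  exists N, forall n, (N <= n)%N -> r ^+ n < e.
Proof.
move=> r0 r1 e0.
have rE : r = (complex.Re r)%:C by rewrite RRe_real ?ger0_real.
have eE : e = (complex.Re e)%:C by rewrite RRe_real ?gtr0_real.
have r1' : `|complex.Re r| < 1.
  by rewrite ger0_norm; [rewrite -ltcR -rE|rewrite -lecR -rE].
have e0' : 0 < complex.Re e by rewrite -ltcR -eE.
have /cvgrPdist_lt/(_ _ e0')[N _ NP] := cvg_geometric 1 r1'.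
exists N => n /NP /=; rewrite sub0r normrN mul1r => h.
rewrite rE eE -rmorphXn ltcR; apply: le_lt_trans h; exact: ler_norm.
Qed.

(** As [A] need not have a unit, [apow x n] is the power of exponent [n + 1]. *)
Definition apow (R : realType) (A : banachAlgType R) (x : A) n : A :=
  iter n (amul x) x.

Lemma compact_elementZ (R : realType) (A : banachAlgType R) (k : R[i]) (a : A) :
  compact_elements A a -> compact_elements A (k *: a).
Proof.
rewrite /compact_elements /compact_operator /= => ca.
pose s (x : A) := (k * k) *: x.
have cs : compact
  (s @` closure [set amul (amul a x) a | x in [set x | `|x| <= 1]]).
  apply: continuous_compact => //; apply: continuous_subspaceT => x.
  exact: scaler_continuous.
apply: (subclosed_compact _ cs); first exact: closed_closure.
have /closure_id -> := compact_closed (@norm_hausdorff _ _) cs.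
apply: closure_subset => _ [x x1 <-].
exists (amul (amul a x) a); first by apply: subset_closure; exists x.
by rewrite /s -scalerA -amulZr -!amulZl.
Qed.

Section idempotents.
Context (R : realType) (A : banachAlgType R) (phi : {linear A -> linfty R}).
Context (phiE : algebra_embedding A (linfty R) phi).
Local Notation "x .@[ i ]" := (entry phi i x) (at level 1, format "x .@[ i ]").
Implicit Types (x y f g : A) (i n : nat).

Lemma entry_apow x n i : (apow x n).@[i] = x.@[i] ^+ n.+1.
Proof. by elim: n => [|n IH]; rewrite ?expr1// /= (entryM phiE) IH -exprS. Qed.

(** If the power had norm [M < 1], all coordinates of [x] would be bounded by
    the root of [M] of the same order. *)
Lemma norm_apow1 x n : `|x| = 1 -> `|apow x n| = 1.
Proof.
move=> x1; apply/eqP; rewrite eq_le; apply/andP; split.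
  apply: (norm_le_entry phiE) => i; rewrite entry_apow normrX.
  by rewrite exprn_ile1// -x1 (entry_le phiE).
rewrite -(@rootCK _ n.+1 isT `|apow x n|) -[1](@expr1n _ n.+1).
rewrite lerXn2r ?nnegrE ?rootC_ge0//.
rewrite -x1; apply: (norm_le_entry phiE) => i.
rewrite -(@ler_pXn2r _ n.+1) ?nnegrE ?rootC_ge0//.
by rewrite rootCK// -normrX -entry_apow (entry_le phiE).
Qed.

(** By compactness there are powers of [y] of exponents [m] and [m + p] close to
    each other, with [p] as large as desired.  At a coordinate where [y] has
    modulus one, the power of exponent [p] is then close to 1, and elsewhere it
    is close to 0.  So a cluster point [f] of such powers of exponent [p] is the
    idempotent announced; it has norm one as all these powers have. *)
Lemma power_idempotent (S : set A) y :
  compact S -> (forall n, S (apow y n)) -> `|y| = 1 ->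
  exists f, [/\ forall i, `|y.@[i]| = 1 -> f.@[i] = 1,
    forall i, `|y.@[i]| <> 1 -> f.@[i] = 0,
    f <> 0 &
    forall e N, 0 < e -> exists2 n, (N <= n)%N & `|f - apow y n| < e].
Proof.
move=> cS Sy y1.
have [c _ cP] := compact_sequence_cluster cS Sy.
have h0 : 0 < 2^-1 :> R[i] by rewrite invr_gt0.
have h1 : 2^-1 < 1 :> R[i] by rewrite invf_lt1// ltr1n.
have : forall N, exists n, (N <= n)%N /\
    forall i, `|y.@[i]| = 1 -> `|1 - y.@[i] ^+ n.+1| < 2^-1 ^+ N.
  move=> N.
  have e0 : 0 < 2^-1 ^+ N / 2 :> R[i] by rewrite mulr_gt0// exprn_gt0.
  have [m _ cm] := cP _ 0%N e0.
  have [k mk ck] := cP _ (m + N).+1 e0.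
  have [q Nq kE] : exists2 q, (N <= q)%N & k = (m + q.+1)%N.
    have mk' : (m < k)%N by rewrite (leq_trans _ mk)// ltnS leq_addr.
    exists (k - m.+1)%N; first by rewrite leq_subRL ?addSn.
    by rewrite addnS -addSn subnKC.
  rewrite {}kE in ck; exists q; split=> //.
  move=> i yi1.
  have : `|apow y m - apow y (m + q.+1)| < 2^-1 ^+ N.
    rewrite [ltRHS](splitr) -(subrKA c); apply: le_lt_trans (ler_normD _ _) _.
    by rewrite ltrD// distrC.
  apply: le_lt_trans; apply: le_trans (entry_le phiE i _).
  rewrite entryB !entry_apow -addSn exprD -{1}[_ ^+ m.+1]mulr1 -mulrBr.
  by rewrite normrM normrX yi1 expr1n mul1r.
move=> /choice[nn nnP].
have [f _ fP] := compact_sequence_cluster cS (fun N => Sy (nn N)).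
have fP' e N : 0 < e -> exists n M,
    [/\ (M <= n)%N, (N <= M)%N, `|f - apow y n| < e &
    forall i, `|y.@[i]| = 1 -> `|1 - y.@[i] ^+ n.+1| < 2^-1 ^+ M].
  move=> e0; have [M NM fM] := fP e N e0.
  by have [? ?] := nnP M; exists (nn M), M.
exists f; split.
- move=> i yi1; apply: (@eq_of_approx _ R[i]^o) => e e0.
  have e2 : 0 < e / 2 by rewrite divr_gt0.
  have [N NP] := expr_small (ltW h0) h1 e2.
  have [n [M [Mn NM fn yn]]] := fP' _ N e2.
  rewrite [leRHS]splitr -(subrKA (y.@[i] ^+ n.+1)).
  apply: le_trans (ler_normD _ _) _; apply: lerD.
    rewrite -entry_apow -entryB; exact/(le_trans (entry_le phiE _ _))/ltW.
  rewrite distrC; apply: ltW; apply: lt_trans (yn _ yi1) _; exact: NP.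
- move=> i yi1; apply: (@eq_of_approx _ R[i]^o) => e e0.
  have e2 : 0 < e / 2 by rewrite divr_gt0.
  have yi1' : `|y.@[i]| < 1.
    by rewrite lt_neqAle -{2}y1 (entry_le phiE) andbT; apply/eqP.
  have [N NP] := expr_small (normr_ge0 _) yi1' e2.
  have [n [M [Mn NM fn _]]] := fP' _ N e2.
  rewrite [leRHS]splitr -(subrKA (y.@[i] ^+ n.+1)).
  apply: le_trans (ler_normD _ _) _; apply: lerD.
    rewrite -entry_apow -entryB; exact/(le_trans (entry_le phiE _ _))/ltW.
  rewrite subr0 normrX; apply/ltW/NP.
  by rewrite (leq_trans NM)// (leq_trans Mn).
- move=> f0; have [n [M [_ _]]] := fP' 1 0%N ltr01.
  by rewrite f0 sub0r normrN norm_apow1// ltxx.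
- move=> e N e0; have [n [M [Mn NM fn _]]] := fP' e N e0.
  by exists n => //; exact: leq_trans Mn.
Qed.

(** An idempotent [e] obtained from powers of [a] absorbs [e A] into the compact
    set [S], since [x = e x] is a limit of elements [a^n x = a (a^(n-2) x) a],
    which are in the image of the unit ball.  The set [I] of idempotents
    below [e] and equal to 1 at [n0] is closed under products, so its lower
    sections [D f] generate a filter on [S]; a cluster point [g] of it is the
    least element of [I]. *)
Lemma minimal_idempotent a : compact_elements A a -> a <> 0 ->
  exists g n0, [/\ g.@[n0] = 1, forall i, g.@[i] = 0 \/ g.@[i] = 1 &
    forall x, amul g x = x.@[n0] *: g].
Proof.
wlog a1 : a / `|a| = 1.
  move=> H ca a0; have na0 : `|a| != 0 by rewrite normr_eq0; apply/eqP.
  apply: (H (`|a|^-1 *: a)); last 2 first.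
  - exact: compact_elementZ.
  - by move/eqP; rewrite scaler_eq0 invr_eq0 (negbTE na0) => /eqP.
  by rewrite normrZ normfV normr_id mulVf.
rewrite /compact_elements /compact_operator /= => cS _.
set E := _ @` _ in cS; set S := closure E in cS.
(* Powers of [a^3] have the form [a x a] required to lie in [E]. *)
pose y := apow a 2.
have norm0_neq1 : `|0 : R[i]| <> 1.
  by rewrite normr0; apply/eqP; rewrite eq_sym oner_eq0.
have y1 : `|y| = 1 by exact: norm_apow1.
have yE n : exists2 x, `|x| <= 1 & apow y n = amul (amul a x) a.
  elim: n => [|n [x x1 xE]]; first by exists a; rewrite ?a1// /y /apow /= amulA.
  exists (amul y x).
    by apply: le_trans (normr_amul_le _ _) _; rewrite y1 mul1r.
  rewrite /apow iterS -/(apow y n) xE; apply: (entry_inj phiE) => i.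
  by rewrite !(entryM phiE); ring.
have Sy n : S (apow y n).
  by apply: subset_closure; have [x x1 ->] := yE n; exists x.
have [e [e1 e0 eN0 eP]] := power_idempotent cS Sy y1.
have e01 i : e.@[i] = 0 \/ e.@[i] = 1.
  by have [?|?] := pselect (`|y.@[i]| = 1); [right; exact: e1|left; exact: e0].
have Sball x : `|x| <= 1 -> (forall i, e.@[i] = 0 -> x.@[i] = 0) -> S x.
  move=> x1 xe; apply: approx_closure => d d0.
  have [n _ nP] := eP d 0%N d0; have [z z1 zE] := yE n.
  exists (amul (apow y n) x).
    exists (amul z x).
      by rewrite /= (le_trans (normr_amul_le _ _))// mulr_ile1.
    rewrite zE; apply: (entry_inj phiE) => i.
    by rewrite !(entryM phiE); ring.
  rewrite (_ : x - _ = amul (e - apow y n) x).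
    apply: le_lt_trans (normr_amul_le _ _) _.
    by apply: le_lt_trans nP; rewrite ler_piMr.
  apply: (entry_inj phiE) => i; rewrite (entryM phiE) !entryB (entryM phiE).
  by have [/[dup]/xe-> ->|->] := e01 i; rewrite ?mulr0 ?subr0// mulrBl mul1r.
have [n0 en0] : exists n0, e.@[n0] = 1.
  apply: contrapT => /forallNP ne; apply: eN0; apply: (entry_inj phiE) => i.
  by rewrite entry0; have [//|/ne] := e01 i.
pose I := [set f | [/\ forall i, f.@[i] = 0 \/ f.@[i] = 1,
  forall i, e.@[i] = 0 -> f.@[i] = 0 & f.@[n0] = 1]].
have IS : I `<=` S.
  move=> f [f01 fe _]; apply: Sball fe; apply: (norm_le_entry phiE) => i.
  by have [->|->] := f01 i; rewrite ?normr0 ?normr1.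
pose D f := [set g | I g /\ forall i, f.@[i] = 0 -> g.@[i] = 0].
have Ie : I e by [].
pose F := filter_from I D.
have FF : ProperFilter F.
  apply: filter_from_proper; last by move=> f If; exists f.
  apply: filter_from_filter; first by exists e.
  move=> f g [f01 fe fn0] [g01 ge gn0]; exists (amul f g).
    split=> [i|i ei|]; rewrite (entryM phiE); last by rewrite fn0 gn0 mulr1.
      by have [->|->] := f01 i; rewrite ?mul0r ?mul1r//; left.
    by rewrite fe// mul0r.
  by move=> h [Ih hfg]; split; split=> // i fi0; apply: hfg;
    rewrite (entryM phiE) fi0 ?mul0r ?mulr0.
have FS : F S by exists e => // g [Ig _]; exact: IS.
have [g [_ gF]] := cS F FF FS.
have gcl f : I f -> closure (D f) g.
  by move=> If B gB; apply: gF => //; exists f.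
have g01 i : g.@[i] = 0 \/ g.@[i] = 1.
  by apply: (closure_entry2 phiE (gcl _ Ie)) => h [[]].
have gn0 : g.@[n0] = 1.
  have [] : g.@[n0] = 1 \/ g.@[n0] = 1 => //.
  by apply: (closure_entry2 phiE (gcl _ Ie)) => h [[]]; left.
have gmin f i : I f -> f.@[i] = 0 -> g.@[i] = 0.
  move=> If fi0; have [] : g.@[i] = 0 \/ g.@[i] = 0 => //.
  by apply: (closure_entry2 phiE (gcl _ If)) => h [_ hf]; left; exact: hf.
(* If [z] were nonzero, its powers would produce an idempotent [f <> 0] below
   [g] with [f_n0 = 0]; then [g - f] is in [I], against minimality of [g]. *)
have rigid z : (forall i, g.@[i] = 0 -> z.@[i] = 0) -> z.@[n0] = 0 -> z = 0.
  move=> zg zn0; apply: contrapT => z0.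
  have nz0 : `|z| != 0 by rewrite normr_eq0; apply/eqP.
  pose w := `|z|^-1 *: z.
  have w1 : `|w| = 1 by rewrite normrZ normfV normr_id mulVf.
  have wg i : g.@[i] = 0 -> w.@[i] = 0.
    by move=> /zg zi; rewrite entryZ zi mulr0.
  have Sw n : S (apow w n).
    apply: Sball => [|i ei]; first by rewrite norm_apow1.
    by rewrite entry_apow wg ?expr0n// (gmin e).
  have [f [f1 f0 fN0 _]] := power_idempotent cS Sw w1.
  have f01 i : f.@[i] = 0 \/ f.@[i] = 1.
    by have [?|?] := pselect (`|w.@[i]| = 1);
      [right; exact: f1|left; exact: f0].
  have fg i : g.@[i] = 0 -> f.@[i] = 0.
    by move=> gi; apply: f0; rewrite wg.
  have Igf : I (g - f).
    split=> [i|i ei|]; rewrite entryB.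
    - have [/[dup]/fg-> ->|->] := g01 i; first by rewrite subr0; left.
      by have [->|->] := f01 i; rewrite ?subr0 ?subrr; [right|left].
    - by rewrite fg (gmin e)// subrr.
    - by rewrite gn0 f0 ?subr0// entryZ zn0 mulr0.
  apply: fN0; apply: (entry_inj phiE) => i; rewrite entry0.
  have [//|fi1] := f01 i; have [/fg//|gi1] := g01 i.
  have : g.@[i] = 0 by apply: gmin Igf _; rewrite entryB gi1 fi1 subrr.
  by rewrite gi1 => /eqP; rewrite oner_eq0.
exists g, n0; split=> // x; apply/eqP; rewrite -subr_eq0; apply/eqP/rigid.
  by move=> i gi; rewrite entryB entryZ (entryM phiE) gi mulr0 mul0r subrr.
by rewrite entryB entryZ (entryM phiE) gn0 mulr1 mul1r subrr.
Qed.

End idempotents.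

(** * Splitting off a minimal idempotent *)

Section split_embedding.
Context (R : realType) (A : banachAlgType R) (phi : {linear A -> linfty R}).
Context (g : A) (n0 : nat).
Local Notation "x .@[ i ]" := (entry phi i x) (at level 1, format "x .@[ i ]").

(** When [g A] is the line through [g], the algebra [A] is the direct sum of
    that line and of [(1 - g) A]; coordinate 0 records the first summand and
    the other coordinates the image of the second one under [phi]. *)
Definition split_seq (x : A) (n : nat) : R[i]^o :=
  if n is m.+1 then (x - amul g x).@[m] else x.@[n0].

Lemma split_seq_bounded x : split_seq x \in @bounded_seqs R.
Proof.
apply/bounded_seqsP; exists (`|phi x| + `|phi (x - amul g x)|) => -[|n].
  by rewrite (le_trans (linfty_norm_ub _ _))// lerDl.
by rewrite (le_trans (linfty_norm_ub _ _))// lerDr.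
Qed.

Definition split_map (x : A) : linfty R := Linfty (split_seq_bounded x).

Lemma split_map_linear : linear split_map.
Proof.
move=> k x y; apply: linfty_seqP => -[|n]; rewrite linfty_seqD linfty_seqZ /=.
  by rewrite entryD entryZ.
rewrite -entryZ -entryD; congr (entry phi n _).
by rewrite amulDr amulZr scalerBr opprD addrACA.
Qed.

HB.instance Definition _ :=
  GRing.isLinear.Build R[i] A (linfty R) _ split_map split_map_linear.

Context (phi_inj : injective phi).
Context (phiM : forall x y, phi (amul x y) = amul (phi x) (phi y)).
Context (gn0 : g.@[n0] = 1).
Context (g01 : forall i, g.@[i] = 0 \/ g.@[i] = 1).
Context (gE : forall x, amul g x = x.@[n0] *: g).

Let gM i x : (amul g x).@[i] = g.@[i] * x.@[i]. Proof. exact: hom_entryM. Qed.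

(** On the support of [g] all coordinates agree with the one at [n0]; dropping
    them from [phi] and keeping a single copy loses nothing. *)
Let on_support i x : g.@[i] = 1 -> x.@[i] = x.@[n0].
Proof.
by move=> gi; have := gM i x; rewrite gE entryZ gi mulr1 mul1r.
Qed.

Lemma split_map_inj : injective split_map.
Proof.
move=> x y xy; apply: (injective_entry phi_inj) => i.
have eq n : split_seq x n = split_seq y n.
  by have := congr1 (fun z : linfty R => linfty_seq z n) xy.
have [gi|gi] := g01 i; last by rewrite !(on_support _ gi); exact: eq 0%N.
by have := eq i.+1; rewrite /= !entryB !gM gi !mul0r !subr0.
Qed.

Lemma split_mapM x y :
  split_map (amul x y) = amul (split_map x) (split_map y).
Proof.
apply: linfty_seqP => -[|n] /=; first exact: hom_entryM.
rewrite !entryB !gM !(hom_entryM _ _ _ phiM).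
by have [->|->] := g01 n; ring.
Qed.

Lemma split_map_norm x : linfty_norm (split_map x) = linfty_norm (phi x).
Proof.
apply/eqP; rewrite eq_le; apply/andP; split; apply: linfty_norm_le => i.
  case: i => [|i] /=; first exact: linfty_norm_ub.
  rewrite entryB gM; have [->|gi] := g01 i.
    by rewrite mul0r subr0; exact: linfty_norm_ub.
  by rewrite gi mul1r subrr normr0 (le_trans _ (linfty_norm_ub _ 0)).
have [gi|gi] := g01 i.
  apply: le_trans (linfty_norm_ub _ i.+1).
  by rewrite /= entryB gM gi mul0r subr0.
apply: le_trans (linfty_norm_ub _ 0%N).
by rewrite /= -(on_support _ gi).
Qed.

Lemma split_map_c0 : c0 R (split_map g).
Proof.
apply/cvgrPdist_lt => e e0; exists 1%N => // -[//|n] _ /=.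
rewrite entryB gM.
by have [->|->] := g01 n; rewrite ?mulr0 ?mulr1 subrr subrr normr0.
Qed.

Lemma split_map_not_avoids :
  ~ avoids (split_map : {linear A -> linfty R}) (c0 R).
Proof.
move=> av; have : split_map g = 0.
  have : [set 0] (split_map g); last by [].
  by rewrite -av; split; [exists g|exact: split_map_c0].
move=> /(congr1 (fun z : linfty R => linfty_seq z 0%N)) /= /eqP.
by rewrite gn0 oner_eq0.
Qed.

End split_embedding.

Lemma compact_elements0 (R : realType) (A : banachAlgType R) :
  compact_elements A 0.
Proof.
rewrite /compact_elements /compact_operator /=.
rewrite (_ : _ @` _ = [set 0]).
  rewrite -(closure_id [set 0 : A]).1; first exact: compact_set1.
  exact: accessible_closed_set1 (hausdorff_accessible (@norm_hausdorff _ _)) _.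
have amulx0 (x : A) : amul x 0 = 0.
  by rewrite -{1}(scale0r (0 : A)) amulZr scale0r.
apply/seteqP; split=> [_ [x _ <-]|_ ->] /=; first exact: amulx0.
by exists 0; [rewrite /= normr0 ler01|exact: amulx0].
Qed.

(** Both kinds of embeddings are covered: all that is used about the class [E]
    is that its members are isometric homomorphisms and that it is stable under
    splitting off an idempotent. *)
Lemma universally_avoids_c0_iff (R : realType) (A : banachAlgType R)
    (E : {linear A -> linfty R} -> Prop) :
  (forall phi, E phi -> algebra_embedding A (linfty R) phi) ->
  (forall phi (g : A) n0, E phi -> entry phi n0 g = 1 ->
    (forall i, entry phi i g = 0 \/ entry phi i g = 1) ->
    (forall x, amul g x = entry phi n0 x *: g) ->
    E (split_map phi g n0)) ->
  embeddable E ->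
  (universally_embeddable_avoiding E (c0 R) <-> compact_elements A = [set 0]).
Proof.
move=> Ealg Esplit [phi0 Ephi0]; split=> [[_ av]|K0].
  apply/seteqP; split=> [a ca /=|_ ->]; last exact: compact_elements0.
  apply: contrapT => a0.
  have phi0E := Ealg _ Ephi0; have [phi0I phi0M _] := phi0E.
  have [g [n0 [gn0 g01 gE]]] := minimal_idempotent phi0E ca a0.
  apply: (split_map_not_avoids phi0M gn0 g01); apply: av; exact: Esplit.
have av phi : E phi -> avoids phi (c0 R).
  move=> /Ealg phiE; apply/seteqP; split=> [_ [[a _ <-]]|_ ->] /=.
    by move=> /(c0_compact_element phiE); rewrite K0 => ->; rewrite linear0.
  by split; [exists 0; rewrite ?linear0|exact: (@cvg_cst R[i]^o)].
by split=> //; exists phi0 => //; exact: av.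
Qed.

(** * Square roots in abelian C*-algebras *)

Section banach_identities.
Context (R : realType) (A : banachAlgType R).
Implicit Types x y z : A.

Lemma amulNl x y : amul (- x) y = - amul x y.
Proof. by rewrite -scaleN1r amulZl scaleN1r. Qed.

Lemma amul_subsqr x y : abelian_algebra A ->
  amul x x - amul y y = amul (x - y) (x + y).
Proof.
by move=> com; rewrite amulDl !amulDr !amulNl (com y x) addrA addrK.
Qed.
End banach_identities.

Section square_root.
Context (R : realType) (A : cstarAlgType R).
Implicit Types x y z : A.

Lemma starN x : star (- x) = - star x.
Proof.
rewrite -scaleN1r starZ [X in X *: _](_ : _ = -1) ?scaleN1r//.
exact: (rmorphN1 Num.conj).
Qed.

Lemma starB x y : star (x - y) = star x - star y.
Proof. by rewrite starD starN. Qed.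

Lemma norm_star x : `|star x| = `|x|.
Proof.
have le y : `|y| <= `|star y|.
  have [->|y0] := eqVneq y 0; first by rewrite normr0.
  rewrite -(@ler_pM2r _ `|y|) ?normr_gt0// -expr2 -normr_amul_star.
  exact: normr_amul_le.
by apply/eqP; rewrite eq_le le -{2}[x]starK le.
Qed.

Lemma normalized_square x : x != 0 ->
  let h := `|x| ^- 2 *: amul (star x) x in star h = h /\ `|h| = 1.
Proof.
rewrite -normr_eq0 => x0; split.
  rewrite starZ starM starK; congr (_ *: _).
  by apply/CrealP/ger0_real; rewrite invr_ge0 exprn_ge0.
rewrite normrZ normr_amul_star ger0_norm ?invr_ge0 ?exprn_ge0//.
by rewrite mulVf// expf_neq0.
Qed.

Lemma norm_self_adjoint_sqr x : star x = x -> `|amul x x| = `|x| ^+ 2.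
Proof. by move=> sx; rewrite -{1}sx normr_amul_star. Qed.

(** The iteration [z |-> (x + z^2) / 2] for the root [z = 1 - sqrt (1 - x)] need
    not be a contraction when [|x| = 1].  Its convergence is controlled by the
    same iteration for the number 1, which is increasing and bounded by 1. *)
Fixpoint majorant (n : nat) : R :=
  if n is m.+1 then (1 + majorant m ^+ 2) / 2 else 0.

Lemma majorant01 n : 0 <= majorant n <= 1.
Proof.
elim: n => [|n /andP[q0 q1]] /=; first by rewrite lexx ler01.
by apply/andP; split; nra.
Qed.

Lemma majorant_nd : {homo majorant : n m / (n <= m)%N >-> n <= m}.
Proof.
apply: homo_leq => [//|x y z|n]; first exact: le_trans.
rewrite /=; have /andP[] := majorant01 n.
by move: (majorant n) => q q0 q1; have := sqr_ge0 (1 - q); nra.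
Qed.

Fixpoint sqrt_iter (x : A) (n : nat) : A :=
  if n is m.+1 then
    2^-1 *: (x + amul (sqrt_iter x m) (sqrt_iter x m)) else 0.

Local Notation half := (2^-1 : R[i]).

Let realCB (a b : R) : (a - b)%:C = a%:C - b%:C :> R[i].
Proof. exact: rmorphB. Qed.

Let realCD (a b : R) : (a + b)%:C = a%:C + b%:C :> R[i].
Proof. exact: rmorphD. Qed.

Lemma majorantSC n :
  (majorant n.+1)%:C = half * (1 + (majorant n)%:C * (majorant n)%:C).
Proof.
rewrite /= mulrC rmorphM rmorphD rmorphXn /= expr2; congr (_ * _).
by rewrite fmorphV rmorph_nat.
Qed.

Lemma norm_half : `|half| = half.
Proof. by rewrite ger0_norm// invr_ge0. Qed.

Lemma sqrt_iter_le x n : `|x| <= 1 -> `|sqrt_iter x n| <= (majorant n)%:C.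
Proof.
move=> x1; elim: n => [|n IH]; first by rewrite normr0.
rewrite majorantSC /= normrZ norm_half ler_wpM2l ?invr_ge0//.
apply: le_trans (ler_normD _ _) _; rewrite lerD//.
by apply: le_trans (normr_amul_le _ _) _; rewrite ler_pM.
Qed.

(** Differences of squares factor, in [A] as for the majorant, so the bound on
    the steps propagates. *)
Lemma sqrt_iter_step x n : abelian_algebra A -> `|x| <= 1 ->
  `|sqrt_iter x n.+1 - sqrt_iter x n| <= (majorant n.+1 - majorant n)%:C.
Proof.
move=> com x1; elim: n => [|n IH].
  rewrite !subr0; exact: sqrt_iter_le.
rewrite realCB [X in _ <= X - _]majorantSC [X in _ <= _ - X]majorantSC.
rewrite [X in `|X - _|]/= [X in `|_ - X|]/= -scalerBr normrZ norm_half.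
rewrite -mulrBr ler_wpM2l ?invr_ge0//.
rewrite opprD addrACA subrr add0r amul_subsqr//.
apply: le_trans (normr_amul_le _ _) _.
rewrite [leRHS](_ : _ = ((majorant n.+1)%:C - (majorant n)%:C) *
  ((majorant n.+1)%:C + (majorant n)%:C)); last by ring.
rewrite -realCB ler_pM//; apply: le_trans (ler_normD _ _) _.
by apply: lerD; [exact: (sqrt_iter_le n.+1)|exact: sqrt_iter_le].
Qed.

Lemma sqrt_iter_dist x n m : abelian_algebra A -> `|x| <= 1 -> (n <= m)%N ->
  `|sqrt_iter x m - sqrt_iter x n| <= (majorant m - majorant n)%:C.
Proof.
move=> com x1; elim: m => [|m IH].
  by rewrite leqn0 => /eqP->; rewrite !subrr normr0.
rewrite leq_eqVlt => /predU1P[->|/IH{}IH]; first by rewrite !subrr normr0.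
rewrite -(subrKA (sqrt_iter x m)); apply: le_trans (ler_normD _ _) _.
rewrite -(subrKA (majorant m)) realCD lerD//; exact: sqrt_iter_step.
Qed.

Lemma sqrt_iter_cvg x : abelian_algebra A -> `|x| <= 1 ->
  exists z, forall e, 0 < e -> exists n, `|z - sqrt_iter x n| < e /\
    `|z - sqrt_iter x n.+1| < e.
Proof.
move=> com x1.
have : cvg (majorant @ \oo).
  apply: nondecreasing_is_cvgn; first exact: majorant_nd.
  by exists 1 => _ [n _ <-]; have /andP[] := majorant01 n.
move=> /cvg_cauchy/cauchy_ballP cq.
have : cauchy (sqrt_iter x @ \oo).
  apply/cauchy_ballP => e e0.
  have eE : e = (complex.Re e)%:C by rewrite RRe_real ?gtr0_real.
  have e0' : 0 < complex.Re e by rewrite -ltcR -eE.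
  have [[P Q] [[N _ NP] [M _ MQ]] PQ] := cq _ e0'.
  pose K := maxn N M.
  pose T := [set sqrt_iter x n | n in [set n | (K <= n)%N]].
  have FT : (sqrt_iter x @ \oo) T by exists K => // n Kn; exists n.
  have d n m : (K <= n)%N -> (n <= m)%N -> `|sqrt_iter x n - sqrt_iter x m| < e.
    move=> Kn nm; rewrite distrC.
    apply: le_lt_trans (sqrt_iter_dist com x1 nm) _.
    rewrite eE ltcR; apply: le_lt_trans (ler_norm _) _.
    have : ball (majorant m) (complex.Re e) (majorant n).
      apply: (PQ (majorant m, majorant n)); split; [apply: NP|apply: MQ] => /=.
        by rewrite (leq_trans _ (leq_trans Kn nm))// leq_maxl.
      by rewrite (leq_trans _ Kn)// leq_maxr.
    by rewrite -ball_normE.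
  exists (T, T) => //.
  move=> [_ _] /= [[n Kn <-] [m Km <-]]; rewrite -ball_normE /=.
  by have [nm|/ltnW mn] := leqP n m; [exact: d|rewrite distrC; exact: d].
move=> /cauchy_cvg/cvg_ex[z /cvgrPdist_lt zP]; exists z => e e0.
have [N _ NP] := zP e e0; exists N; split; apply: NP => //=.
Qed.

(** The equation says [(1 - z)^2 = 1 - x], written without a unit. *)
Lemma sqrt_one_sub x : abelian_algebra A -> star x = x -> `|x| <= 1 ->
  exists z, [/\ star z = z, `|z| <= 1 & x = 2%:R *: z - amul z z].
Proof.
move=> com sx x1; have [z zP] := sqrt_iter_cvg com x1.
have s1 n : `|sqrt_iter x n| <= 1.
  apply: le_trans (sqrt_iter_le n x1) _.
  by rewrite -(rmorph1 (real_complex R)) lecR; have /andP[] := majorant01 n.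
have ss n : star (sqrt_iter x n) = sqrt_iter x n.
  elim: n => [|n IH] /=.
    by apply: (addrI (star 0)); rewrite -starD !addr0.
  rewrite starZ starD sx starM IH; congr (_ *: _).
  by rewrite (fmorphV Num.conj) (rmorph_nat Num.conj).
have z1 : `|z| <= 1.
  apply/ler_addgt0Pl => e e0; have [n [zn _]] := zP e e0.
  rewrite -[z](subrK (sqrt_iter x n)); apply: le_trans (ler_normD _ _) _.
  by rewrite lerD// ltW.
exists z; split=> //.
  apply: eq_of_approx => e e0.
  have [n [zn _]] := zP (e / 2) (divr_gt0 e0 (ltr0Sn _ 1)).
  rewrite [leRHS]splitr -(subrKA (sqrt_iter x n)).
  apply: le_trans (ler_normD _ _) _; rewrite lerD//.
    by rewrite -ss -starB norm_star ltW.
  by rewrite distrC ltW.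
apply: eq_of_approx => e e0.
have e4 : 0 < e / 4 by rewrite divr_gt0.
have [n [zn zn1]] := zP _ e4.
have zE : x = 2%:R *: sqrt_iter x n.+1 - amul (sqrt_iter x n) (sqrt_iter x n).
  by rewrite /= scalerA mulfV ?pnatr_eq0// scale1r addrK.
rewrite {1}zE opprD addrACA opprK -scalerBr [X in _ + X]addrC amul_subsqr//.
apply: le_trans (ler_normD _ _) _.
rewrite [leRHS](_ : e = 2 * (e / 4) + (e / 4) * 2); last by field.
rewrite lerD// ?normrZ ?normr_nat ?ler_wpM2l// 1?distrC; first exact: ltW.
apply: le_trans (normr_amul_le _ _) _; rewrite ler_pM//; first exact: ltW.
by apply: le_trans (ler_normD _ _) _; rewrite -[2]/(1 + 1) lerD.
Qed.

End square_root.

(** * Embeddings of abelian C*-algebras are isometric *)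

Section star_embeddings.
Context (R : realType) (A : cstarAlgType R) (phi : {linear A -> linfty R}).
Context (com : abelian_algebra A).
Context (phiE : star_embedding A (linfty R) phi).
Local Notation "x .@[ i ]" := (entry phi i x) (at level 1, format "x .@[ i ]").
Implicit Types x y h k b c : A.

Let phiI : injective phi. Proof. by case: phiE. Qed.

Let entM i x y : (amul x y).@[i] = x.@[i] * y.@[i].
Proof. by apply: hom_entryM; case: phiE. Qed.

Let ent_inj x y : (forall i, x.@[i] = y.@[i]) -> x = y.
Proof. exact: injective_entry. Qed.

Lemma entry_star i x : (star x).@[i] = (x.@[i])^*.
Proof. by case: phiE => _ _ phiS; rewrite /entry phiS. Qed.

Lemma entry_real i x : star x = x -> x.@[i] \is Num.real.
Proof. by move=> sx; apply/CrealP; rewrite -{2}sx entry_star. Qed.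

(** [1 - h_i] is the square of the real number [1 - z_i]. *)
Lemma entry_le1 i h : star h = h -> `|h| <= 1 -> h.@[i] <= 1.
Proof.
move=> sh h1; have [z [sz _ hE]] := sqrt_one_sub com sh h1.
rewrite -subr_ge0 (_ : 1 - _ = (1 - z.@[i]) ^+ 2).
  by rewrite real_exprn_even_ge0// realB// entry_real.
by rewrite hE entryB entryZ entM; ring.
Qed.

Lemma star_embedding_contractive i x : `|x.@[i]| <= `|x|.
Proof.
have [->|x0] := eqVneq x 0; first by rewrite entry0 normr0.
have nx0 : 0 < `|x| by rewrite normr_gt0.
rewrite -(@ler_pXn2r _ 2) ?nnegrE//.
have [sh h1] := normalized_square x0.
have := entry_le1 i sh; rewrite h1 lexx => /(_ isT).
rewrite entryZ entM entry_star mulrC.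
by rewrite ler_pdivrMr ?exprn_gt0// mul1r normCK mulrC.
Qed.

(** The hypothesis says that [1 + w] is unitary, without mentioning a unit. *)
Lemma norm_unitary_mul (w : A) b :
  amul (star w) w + w + star w = 0 -> `|b + amul w b| = `|b|.
Proof.
move=> wU; apply/eqP; rewrite -(@eqrXn2 _ 2)// -!normr_amul_star.
apply/eqP; congr `|_|; apply: ent_inj => i.
have : (amul (star w) w + w + star w).@[i] = 0 by rewrite wU entry0.
rewrite starD starM !(entryD, entM) => wi.
rewrite -[RHS]addr0 -[X in _ = _ + X](mulr0 ((star b).@[i] * b.@[i])) -{}wi.
ring.
Qed.

(** With [s = sqrt (1 - k^2) = 1 - v], the element [s + i k] is unitary, and
    [c = 2 k s] is the imaginary part of its square [1 + w].  Multiplication by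
    [1 + w] and by its adjoint preserves the norm, so multiplication by [c]
    does not increase it; testing this on [c] itself yields [|c| <= 1]. *)
Lemma double_angle_le k : star k = k -> `|k| <= 1 ->
  exists2 c, star c = c /\ `|c| <= 1 &
    amul c c = 4%:R *: (amul k k - amul (amul k k) (amul k k)).
Proof.
move=> sk k1; pose h := amul k k.
have sh : star h = h by rewrite /h starM sk.
have h1 : `|h| <= 1.
  by rewrite (le_trans (normr_amul_le _ _))// mulr_ile1.
have [v [sv _ hE]] := sqrt_one_sub com sh h1.
have vE i : k.@[i] * k.@[i] = 2 * v.@[i] - v.@[i] * v.@[i].
  by rewrite -!entM -/h hE entryB entryZ.
pose c := 2%:R *: (k - amul k v).
have sc : star c = c.
  rewrite /c starZ starB starM sk sv (com v); congr (_ *: _).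
  exact: (rmorph_nat Num.conj).
pose w := - (2%:R *: h) + 'i *: c.
pose w' := - (2%:R *: h) - 'i *: c.
have sw : star w = w'.
  rewrite /w starD starN starZ sh starZ sc; congr (- (_ *: _) + _).
    exact: (rmorph_nat Num.conj).
  by rewrite -scaleNr; congr (_ *: _); exact: conjCi.
have sw' : star w' = w by rewrite -sw starK.
have i2 : 'i * 'i = -1 :> R[i] by rewrite -expr2 sqrCi.
have cE i : c.@[i] = 2 * (k.@[i] - k.@[i] * v.@[i]).
  by rewrite entryZ entryB entM.
have wE i : w.@[i] = - (2 * (k.@[i] * k.@[i])) + 'i * c.@[i].
  by rewrite entryD -scaleNr !entryZ entM mulNr.
have w'E i : w'.@[i] = - (2 * (k.@[i] * k.@[i])) - 'i * c.@[i].
  by rewrite entryB -scaleNr !entryZ entM mulNr.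
clearbody w w' c.
have U : amul w' w + w + w' = 0.
  apply: ent_inj => i; rewrite entry0 !entryD entM wE w'E.
  transitivity (4 * (k.@[i] * k.@[i]) *
    (k.@[i] * k.@[i] - (2 * v.@[i] - v.@[i] * v.@[i]))
    - ('i * 'i + 1) * (c.@[i] * c.@[i])); last first.
    by rewrite i2 vE subrr addNr mulr0 mul0r subrr.
  by rewrite cE; ring.
have c1 : `|c| <= 1.
  have : `|(2 * 'i) *: amul c c| <= 2 * `|c|.
    rewrite (_ : _ *: _ = (c + amul w c) - (c + amul w' c)).
      apply: le_trans (ler_normB _ _) _.
      rewrite !norm_unitary_mul ?sw ?sw'//; first by rewrite mulr_natl mulr2n.
      rewrite -U addrAC; congr (_ + _ + _); exact: com.
    apply: ent_inj => i; rewrite entryZ entryB !entryD !entM wE w'E; ring.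
  rewrite normrZ normrM normCi mulr1 normr_nat ler_pM2l ?ltr0Sn//.
  rewrite norm_self_adjoint_sqr// expr2.
  have [->|c0] := eqVneq c 0; first by rewrite normr0 ler01.
  by rewrite -{3}[`|c|]mul1r ler_pM2r// normr_gt0.
exists c => //; apply: ent_inj => i.
rewrite entryZ entryB !entM cE.
transitivity
  (4 * (k.@[i] * k.@[i]) * (1 - (2 * v.@[i] - v.@[i] * v.@[i]))).
  by ring.
by rewrite -vE; ring.
Qed.

(** For [h = k^2], the element [c^2 = 4 h - 4 h^2] satisfies
    [1 - c^2 = (1 - 2 h)^2], so its root is [1 - z = |1 - 2 h|], which in every
    coordinate equals [1 - 2 h] because [h_i <= 1/2].  Thus [z = 2 h] has norm
    two, while roots have [|z| <= 1]. *)
Lemma norm1_entries_not_small k : star k = k -> `|k| = 1 ->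
  (forall i, k.@[i] ^+ 2 <= 2^-1) -> False.
Proof.
move=> sk k1 kle; have k1' : `|k| <= 1 by rewrite k1.
have [c [sc c1] ccE] := double_angle_le sk k1'.
have sx : star (amul c c) = amul c c by rewrite starM sc.
have x1 : `|amul c c| <= 1.
  by rewrite (le_trans (normr_amul_le _ _))// mulr_ile1.
have [z [sz z1 xE]] := sqrt_one_sub com sx x1.
have zE : z = 2%:R *: amul k k.
  apply: ent_inj => i; rewrite entryZ entM.
  have zr : z.@[i] <= 1.
    apply: le_trans (real_ler_norm (entry_real i sz)) _.
    exact: le_trans (star_embedding_contractive _ _) z1.
  have t1 : 0 <= 1 - 2 * (k.@[i] * k.@[i]).
    by rewrite subr_ge0 -expr2 mulrC -ler_pdivlMr ?ltr0Sn// mul1r.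
  have e2 : (1 - z.@[i]) ^+ 2 = (1 - 2 * (k.@[i] * k.@[i])) ^+ 2.
    have : (amul c c).@[i] = 2 * z.@[i] - z.@[i] * z.@[i].
      by rewrite xE entryB entryZ entM.
    rewrite ccE entryZ entryB !entM => e.
    transitivity (1 - (2 * z.@[i] - z.@[i] * z.@[i])); first by ring.
    by rewrite -e; ring.
  have /eqP := e2; rewrite (eqrXn2 _ _ t1) ?subr_ge0// => /eqP.
  by move/(congr1 (fun t => 1 - t)); rewrite !subKr.
have z2 : `|z| = 2.
  by rewrite zE normrZ norm_self_adjoint_sqr// k1 expr1n normr_nat mulr1.
by move: z1; rewrite z2 (ler_nat _ 2 1).
Qed.

Lemma norm_iter_sqr n k : star k = k -> `|k| = 1 ->
  let k' := iter n (fun y => amul y y) k in star k' = k' /\ `|k'| = 1.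
Proof.
move=> sk k1; elim: n => [//|n [sk' k'1]] /=.
by rewrite starM sk' norm_self_adjoint_sqr// k'1 expr1n.
Qed.

Lemma entry_iter_sqr n k i :
  (iter n (fun y => amul y y) k).@[i] = k.@[i] ^+ (2 ^ n).
Proof.
elim: n => [|n IH]; first by rewrite expr1.
by rewrite /= entM IH -exprD expnS mul2n addnn.
Qed.

(** If [|phi x| < |x|], the coordinates of [h = x^* x / |x|^2] are at most some
    [r < 1].  Squaring repeatedly keeps the norm equal to one and makes the
    coordinates small. *)
Lemma star_embedding_isometric : algebra_embedding A (linfty R) phi.
Proof.
have phiM : forall x y, phi (amul x y) = amul (phi x) (phi y) by case: phiE.
split=> // x; apply/eqP; rewrite eq_le; apply/andP; split.
  by apply: linfty_norm_le => i; exact: star_embedding_contractive.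
rewrite real_leNgt ?normr_real//; apply/negP => lt.
have x0 : 0 < `|x| by apply: le_lt_trans lt.
pose h := `|x| ^- 2 *: amul (star x) x.
have [sh h1] : star h = h /\ `|h| = 1.
  by apply: normalized_square; rewrite -normr_gt0.
pose r := (`|phi x| / `|x|) ^+ 2.
have r0 : 0 <= r by rewrite exprn_ge0// divr_ge0.
have r1 : r < 1.
  by rewrite expr_lt1 ?divr_ge0// ltr_pdivrMr// mul1r.
have hr i : 0 <= h.@[i] <= r.
  rewrite entryZ entM entry_star mulrC [_^* * _]mulrC -normCK /r expr_div_n.
  rewrite divr_ge0 ?exprn_ge0//= ler_wpM2r ?invr_ge0 ?exprn_ge0//.
  by rewrite lerXn2r ?nnegrE// linfty_norm_ub.
have half0 : 0 < 2^-1 :> R[i] by rewrite invr_gt0.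
have [N NP] := expr_small r0 r1 half0.
have [sk k1] := norm_iter_sqr N sh h1.
apply: (norm1_entries_not_small sk k1) => i.
have /andP[hi0 hir] := hr i.
rewrite entry_iter_sqr -exprM.
apply: le_trans (ltW (NP (2 ^ N * 2)%N _)); first by rewrite lerXn2r ?nnegrE.
by rewrite (leq_trans (ltnW (ltn_expl N (ltnSn 1))))// leq_pmulr.
Qed.

End star_embeddings.

Lemma split_map_star (R : realType) (A : cstarAlgType R)
    (phi : {linear A -> linfty R}) (g : A) n0 :
  star_embedding A (linfty R) phi -> entry phi n0 g = 1 ->
  (forall i, entry phi i g = 0 \/ entry phi i g = 1) ->
  (forall x, amul g x = entry phi n0 x *: g) ->
  star_embedding A (linfty R) (split_map phi g n0).
Proof.
move=> phiE gn0 g01 gE; have [phiI phiM _] := phiE; split.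
- exact: split_map_inj.
- exact: split_mapM.
move=> x; apply: linfty_seqP => -[|n] /=; first exact: entry_star.
rewrite !entryB !(hom_entryM _ _ _ phiM) (entry_star phiE).
have [->|->] := g01 n; first by rewrite !mul0r !subr0.
by rewrite !mul1r !subrr (rmorph0 Num.conj).
Qed.

Theorem theorem2p5 (R : realType) :
  (forall A : banachAlgType R,
     uniform_algebra A ->
     embeddable (algebra_embedding A (linfty R)) ->
     (universally_embeddable_avoiding
        (algebra_embedding A (linfty R)) (c0 R) <->
      compact_elements A = [set 0])) /\
  (forall A : cstarAlgType R,
     abelian_algebra A ->
     embeddable (star_embedding A (linfty R)) ->
     (universally_embeddable_avoiding
        (star_embedding A (linfty R)) (c0 R) <->
      compact_elements A = [set 0])).
Proof.
split=> A hA emb.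
  apply: universally_avoids_c0_iff emb => // phi g n0 [phiI phiM phiN].
  move=> gn0 g01 gE; split.
  - exact: split_map_inj.
  - exact: split_mapM.
  - by move=> x; rewrite -phiN; exact: split_map_norm.
apply: universally_avoids_c0_iff emb => [phi phiE|phi g n0 phiE gn0 g01 gE].
  exact: star_embedding_isometric.
exact: split_map_star.
Qed.
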